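(* Let $n>1$, $r=2^n$ and $M=14^{2^n}+1$. Let $\pi=1-\zeta_7+\zeta_7^4\in\mathbb{Z}[\zeta_{14}]$ and $\alpha=(\pi/\bar\pi)^{1+3\sigma_5+5\sigma_3}$. For $k\geq0$ define $S_k^{(1)}=\alpha_1^{(k)}+\alpha_2^{(k)}+\alpha_3^{(k)}$, $S_k^{(2)}=\alpha_1^{(k)}\alpha_2^{(k)}+\alpha_1^{(k)}\alpha_3^{(k)}+\alpha_2^{(k)}\alpha_3^{(k)}$, $S_k^{(3)}=\alpha_1^{(k)}\alpha_2^{(k)}\alpha_3^{(k)}$, where $\alpha_1^{(k)}=\alpha^{14^k}+\bar\alpha^{14^k}$, $\alpha_2^{(k)}=\sigma_3(\alpha_1^{(k)})$, $\alpha_3^{(k)}=\sigma_5(\alpha_1^{(k)})$. Suppose that every integer $x$ with $1<x<7^r$ and $x^6\equiv1\pmod{7^r}$ does not divide $M$. Then $M$ is prime if and only if one of the following holds: (i) $M\equiv\pm8\pmod{29}$ and $S_{r-1}^{(1)}\equiv1$, $S_{r-1}^{(2)}\equiv-2$, $S_{r-1}^{(3)}\equiv-1\pmod M$; (ii) $M\equiv-5\pmod{29}$ and $S_{r-1}^{(1)}\equiv-1$, $S_{r-1}^{(2)}\equiv-2$, $S_{r-1}^{(3)}\equiv1\pmod M$.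
   Context: $\zeta_m=e^{2\pi\sqrt{-1}/m}$ and a bar denotes complex conjugation. For $c$ coprime to $14$, $\sigma_c\in G=\mathrm{Gal}(\mathbb{Q}(\zeta_{14})/\mathbb{Q})$ sends $\zeta_{14}$ to $\zeta_{14}^c$; $1$ denotes $\sigma_1$ in $\mathbb{Z}[G]$. For $\tau=\sum_{\sigma\in G}k_\sigma\sigma\in\mathbb{Z}[G]$ and $\beta\neq0$, $\beta^\tau:=\prod_{\sigma}\sigma(\beta)^{k_\sigma}$. The $S_k^{(j)}$ are rational numbers with denominators prime to $M$; congruences modulo $M$ are understood in the ring of rationals with denominator prime to $M$. *)

(* Defs.v *)
From HB Require Import structures.
From mathcomp Require Import all_boot all_order all_algebra all_fingroup all_field.
From mathcomp Require Import reals trigo complex.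

Set Implicit Arguments.
Unset Strict Implicit.
Unset Printing Implicit Defensive.

Import Order.TTheory GRing.Theory Num.Theory.
Local Open Scope ring_scope.

(* e^(2 pi i / m) *)
Definition zeta (R : realType) (m : nat) : R[i] :=
  Complex (cos (2 * pi / m%:R)) (sin (2 * pi / m%:R)).

Section GaloisExponent.
Variable L : splittingFieldType rat.

(* The additive group of Z[G], G = Gal(L/Q): an element is its family of
   integer coefficients; the product of Z[G] is not needed. *)
Definition galZ := {ffun gal_of {:L} -> int}.

Definition galZ_elt (s : gal_of {:L}) : galZ := [ffun t => (t == s)%:R].

Definition galZ_pow (x : L) (tau : galZ) : L :=
  \prod_(s in 'Gal({:L} / 1)%g) s x ^ tau s.

End GaloisExponent.

(* The ring of rationals with denominator prime to M. *)
Definition ratloc (M : nat) : pred rat := [pred q | coprime `|denq q| M].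

(* Congruence modulo the ideal generated by M in that ring. *)
Definition ratloc_congr (M : nat) (x y : rat) : Prop :=
  [/\ x \in ratloc M, y \in ratloc M &
      exists2 q : rat, q \in ratloc M & x - y = M%:R * q].

(* The same for an element of a number field: it has to be a rational number. *)
Definition congr_modQ (L : splittingFieldType rat) (M : nat) (x : L) (y : int)
    : Prop :=
  exists2 q : rat, x = q%:A & ratloc_congr M q y%:~R.

(* Main.v *)
Require Import Defs.
From HB Require Import structures.
From mathcomp Require Import all_boot all_order all_algebra all_fingroup all_field.
From mathcomp Require Import reals trigo complex.
From mathcomp Require Import ring lra zify.
Import Order.TTheory GRing.Theory Num.Theory.
Local Open Scope ring_scope.

(** Write alpha(w) for the rational function of a primitive seventh root of
    unity w that gives alpha at w = zeta_7, and N = 14^(r-1), so M = 14 N + 1.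

    The S_k^(j) are, up to a power of 29, integers given by Galois invariant
    polynomials in zeta_7, so they have the same value for every seventh root of
    unity w in every field of characteristic other than 7 and 29; this allows
    one to work over an algebraic closure of F_l for a prime l.

    If M is prime, let G be the Gauss sum modulo 29 of the character sending the
    primitive root 2 to w, in characteristic M.  Factoring the Jacobi sums gives
    G^7 = - w^2 alpha^3 gamma^7 with alpha gamma^2 = 29, while the action of
    Frobenius gives w^m G^M = G when M = 2^m mod 29.  Together with quadratic
    reciprocity, obtained in the same way from the quadratic Gauss sum, this
    yields alpha^N = (-w)^m, which determines the symmetric functions.

    Conversely, the congruences modulo a prime l dividing M force +-alpha^N to be
    a primitive seventh root of unity, so 7^r divides the order of alpha, hence
    l^6 - 1.  By hypothesis l >= 7^r > sqrt M, and M is prime. *)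

(** * Seventh roots of unity and the conjugates of pi *)

(** The equation [phi7 w = 0] stands for a primitive seventh root of unity in any field; in
    characteristic 7 its only solution is 1. *)
Definition phi7 {F : fieldType} (w : F) : F :=
  1 + w + w ^+ 2 + w ^+ 3 + w ^+ 4 + w ^+ 5 + w ^+ 6.

Definition pi29 {F : fieldType} (w : F) : F := 1 - w + w ^+ 4.

(** Conjugation sends [w ^+ c] to [w ^+ (6 * c)], so the denominator, conjugate to the numerator, is
    taken at the exponents 6, 2 and 4. *)
Definition alpha29 {F : fieldType} (w : F) : F :=
  pi29 w * pi29 (w ^+ 5) ^+ 3 * pi29 (w ^+ 3) ^+ 5
  / (pi29 (w ^+ 6) * pi29 (w ^+ 2) ^+ 3 * pi29 (w ^+ 4) ^+ 5).

Section SeventhRoot.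
Context {F : fieldType} {w : F}.
Hypothesis phi7w : phi7 w = 0.

Lemma phi7_expr7 : w ^+ 7 = 1.
Proof.
apply/eqP; rewrite -subr_eq0; apply/eqP.
have -> : w ^+ 7 - 1 = (w - 1) * phi7 w by rewrite /phi7; ring.
by rewrite phi7w mulr0.
Qed.

Lemma phi7_expr_mod m : w ^+ m = w ^+ (m %% 7).
Proof. by rewrite [in LHS](divn_eq m 7) mulnC exprD exprM phi7_expr7 expr1n mul1r. Qed.

Lemma phi7_neq0 : w != 0.
Proof.
apply/eqP=> w0; have := phi7_expr7; rewrite w0 expr0n /= => /esym/eqP.
by rewrite oner_eq0.
Qed.

Lemma phi7_expr c : ~~ (7 %| c)%N -> phi7 (w ^+ c) = 0.
Proof.
move=> hc; rewrite (phi7_expr_mod c) -phi7w /phi7 -!exprM.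
have : (0 < c %% 7 < 7)%N by rewrite lt0n hc ltn_pmod.
by case: (c %% 7)%N => [|[|[|[|[|[|[|[|?]]]]]]]] // _; rewrite !(phi7_expr_mod (_ * _)) /=; ring.
Qed.

Lemma pi29_expr_mod c : pi29 (w ^+ c) = 1 - w ^+ (c %% 7) + w ^+ (4 * c %% 7).
Proof. by rewrite /pi29 -exprM (phi7_expr_mod c) (phi7_expr_mod (c * 4)) mulnC. Qed.

Lemma pi29_norm :
  pi29 w * pi29 (w ^+ 2) * pi29 (w ^+ 3) * pi29 (w ^+ 4) * pi29 (w ^+ 5)
  * pi29 (w ^+ 6) = 29%:R.
Proof.
(* The long polynomial is the quotient by [phi7]. *)
rewrite !pi29_expr_mod /pi29 /=; apply/eqP; rewrite -subr_eq0; apply/eqP.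
rewrite -[RHS](mul0r (
  - 28 + 28 * w - w ^+ 2 + 2 * w ^+ 3 - 3 * w ^+ 4 + 4 * w ^+ 5 - w ^+ 6 -
  29 * w ^+ 7 + 28 * w ^+ 8 - 2 * w ^+ 9 + 4 * w ^+ 10 - 4 * w ^+ 11 - w
  ^+ 13 - 13 * w ^+ 14 + 13 * w ^+ 15 + 4 * w ^+ 16 - 2 * w ^+ 17 - 5 * w
  ^+ 18 + 3 * w ^+ 20 - w ^+ 21))
  -phi7w /phi7.
ring.
Qed.

Hypothesis nz29 : 29%:R != 0 :> F.

Lemma pi29_neq0 : [&& pi29 w != 0, pi29 (w ^+ 2) != 0, pi29 (w ^+ 3) != 0,
  pi29 (w ^+ 4) != 0, pi29 (w ^+ 5) != 0 & pi29 (w ^+ 6) != 0].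
Proof.
by have := nz29; rewrite -pi29_norm !mulf_eq0 !negb_or -!andbA.
Qed.

Lemma alpha29_neq0 : alpha29 w != 0.
Proof.
have /and5P[? ? ? ? /andP[? ?]] := pi29_neq0.
by rewrite /alpha29 !(mulf_neq0, invr_neq0, expf_neq0).
Qed.

Lemma alpha29_conj : alpha29 (w ^+ 6) = (alpha29 w)^-1.
Proof.
have E m : pi29 (w ^+ 6 ^+ m) = pi29 (w ^+ (6 * m %% 7)) by rewrite -exprM phi7_expr_mod.
by rewrite /alpha29 !E /= expr1 invf_div.
Qed.


End SeventhRoot.

(** * Discrete logarithms modulo 29 *)

(* [2] is a primitive root modulo [29]; the iteration keeps the powers small
   enough to be computed in unary. *)
Definition pow2_29 (k : nat) : nat := iter k (fun a => 2 * a %% 29)%N 1%N.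

(** The Zech logarithm to the base 2. At [m = 14], where 2^m is -1 modulo 29, the search fails and
    [index] returns 28. *)
Definition zech (m : nat) : nat :=
  index ((1 + pow2_29 m) %% 29)%N (map pow2_29 (iota 0 28)).

Lemma pow2_29E k : pow2_29 k = (2 ^ k %% 29)%N.
Proof. by elim: k => //= k IH; rewrite IH modnMmr expnS. Qed.

Lemma pow2_29D j m : (pow2_29 j * pow2_29 m = pow2_29 (j + m) %[mod 29])%N.
Proof. by rewrite !pow2_29E modnMml modnMmr modn_mod expnD. Qed.

Lemma pow2_29_periodic k : pow2_29 (k + 28) = pow2_29 k.
Proof. by rewrite /pow2_29 iterD. Qed.

Lemma pow2_29_zech m : (m < 28)%N -> (m != 14)%N ->
  pow2_29 (zech m) = ((1 + pow2_29 m) %% 29)%N.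
Proof.
move=> hm nm.
have : all (fun m => (m != 14) ==> (pow2_29 (zech m) == ((1 + pow2_29 m) %% 29)))%N
         (iota 0 28) by vm_compute.
by move/allP/(_ m); rewrite mem_iota nm /= => /(_ hm)/eqP.
Qed.

(** For [d = 28], read through the discrete logarithm, this is the substitution of 2^m a for a in a
    sum over the nonzero residues a modulo 29. *)
Lemma sum_shift (F : fieldType) (f : nat -> F) d m :
  (forall k, f (k + d)%N = f k) -> \sum_(k < d) f (k + m)%N = \sum_(k < d) f k.
Proof.
move=> fd; elim: m => [|m IH]; first by apply: eq_bigr => i _; rewrite addn0.
rewrite -IH; case: d fd {IH} => [|d] fd; first by rewrite !big_ord0.
rewrite big_ord_recr big_ord_recl /= add0n addrC; congr (_ + _).
  by rewrite -[RHS]fd; congr f; lia.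
by apply: eq_bigr => i _; congr f; rewrite /bump /=; lia.
Qed.

(** * Gauss and Jacobi sums modulo 29 *)

Section GaussSum.
Context {F : fieldType} {eta : F}.
Hypothesis eta_sum : \sum_(i < 29) eta ^+ i = 0.

Definition gauss (u : F) : F := \sum_(k < 28) u ^+ k * eta ^+ pow2_29 k.

Lemma eta_expr29 : eta ^+ 29 = 1.
Proof. by apply/eqP; rewrite -subr_eq0 subrX1 eta_sum mulr0. Qed.

Lemma eta_expr_mod a b : a = b %[mod 29] -> eta ^+ a = eta ^+ b.
Proof.
have E m : eta ^+ m = eta ^+ (m %% 29).
  by rewrite [in LHS](divn_eq m 29) mulnC exprD exprM eta_expr29 expr1n mul1r.
by move=> h; rewrite E h -E.
Qed.

Lemma gauss_period u (hu : u ^+ 28 = 1) k :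
  u ^+ (k + 28) * eta ^+ pow2_29 (k + 28) = u ^+ k * eta ^+ pow2_29 k.
Proof. by rewrite pow2_29_periodic exprD hu mulr1. Qed.

Lemma gauss1 : gauss 1 = -1.
Proof.
have -> : gauss 1 = \sum_(a <- map pow2_29 (iota 0 28)) eta ^+ a.
  rewrite big_map -[28%N]subn0 -/(index_iota 0 28) big_mkord.
  by apply: eq_bigr => i _; rewrite expr1n mul1r.
rewrite (perm_big (iota 1 28)); last by vm_compute.
apply/eqP; rewrite -subr_eq0 opprK addrC; apply/eqP; rewrite -[RHS]eta_sum.
rewrite -(big_mkord xpredT (fun i => eta ^+ i)) big_nat_recl // expr0.
by rewrite -[iota 1 28]/(index_iota 1 29) big_add1.
Qed.

(** Writing the second residue as 2^(j+m) turns the exponent of [eta] into 2^j (1 + 2^m). For m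
    other than 14, shifting j by [zech m] extracts [gauss (u * v)] with a Jacobi sum as coefficient;
    [28 - zech m] acts as the opposite of [zech m]. For m = 14 the exponent vanishes modulo 29. *)
Lemma gauss_mul u v : u ^+ 28 = 1 -> v ^+ 28 = 1 ->
  gauss u * gauss v =
    (\sum_(m < 28 | m != 14 :> nat) v ^+ m * (u * v) ^+ (28 - zech m))
      * gauss (u * v)
    + v ^+ 14 * \sum_(j < 28) (u * v) ^+ j.
Proof.
move=> hu hv.
have huv : (u * v) ^+ 28 = 1 by rewrite exprMn hu hv mulr1.
have -> : gauss u * gauss v = \sum_(m < 28) v ^+ m *
    \sum_(j < 28) (u * v) ^+ j * eta ^+ (pow2_29 j * (1 + pow2_29 m)).
  rewrite /gauss mulr_suml; under [RHS]eq_bigr do rewrite mulr_sumr.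
  rewrite exchange_big /=; apply: eq_bigr => j _.
  rewrite -(sum_shift _ _ _ j (gauss_period _ hv)) mulr_sumr.
  apply: eq_bigr => m _; rewrite mulnDr muln1 [eta ^+ (_ + _)]exprD.
  rewrite (eta_expr_mod _ _ (pow2_29D _ _)) exprMn [v ^+ (_ + _)]exprD (addnC m); ring.
rewrite (bigID (fun m : 'I_28 => m != 14 :> nat)) /=; congr (_ + _).
  rewrite mulr_suml; apply: eq_bigr => m nm; rewrite -mulrA; congr (_ * _).
  rewrite /gauss -(sum_shift _ _ _ (zech m) (gauss_period _ huv)) mulr_sumr.
  apply: eq_bigr => j _; rewrite mulrA -exprD.
  have -> : (28 - zech m + (j + zech m) = j + 28)%N.
    have : (zech m <= 28)%N by exact: index_size.
    by lia.
  rewrite exprD huv mulr1; congr (_ * _); apply: eta_expr_mod.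
  by rewrite -pow2_29D (pow2_29_zech _ (ltn_ord m) nm) modnMmr.
rewrite (bigD1 (inord 14)) /= ?inordK // [X in _ + X]big1 ?addr0; last first.
  by move=> i; rewrite -val_eqE /= inordK // negbK => /andP[->].
congr (_ * _); apply: eq_bigr => j _.
rewrite (eta_expr_mod _ 0%N) ?expr0 ?mulr1 //.
by rewrite -modnMmr muln0.
Qed.

(** The Jacobi sum is [- v ^+ 14], what a vanishing geometric sum leaves without its middle term.
    Multiplied by [gauss 1], which is -1, it adds one to the 28 trivial terms. *)
Lemma gauss_mul_inv u v : u * v = 1 -> v ^+ 28 = 1 -> \sum_(j < 28) v ^+ j = 0 ->
  gauss u * gauss v = 29%:R * v ^+ 14.
Proof.
move=> uv hv sv.
have hu : u ^+ 28 = 1 by rewrite -[LHS]mulr1 -hv -exprMn uv expr1n.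
rewrite gauss_mul // uv gauss1.
under eq_bigr do rewrite expr1n mulr1.
under [X in _ + _ * X]eq_bigr do rewrite expr1n.
rewrite sumr_const card_ord.
move: sv; rewrite (bigD1 (inord 14)) /= ?inordK // => sv.
have -> : \sum_(m < 28 | m != 14 :> nat) v ^+ m = - v ^+ 14.
  apply/eqP; rewrite -subr_eq0 opprK addrC; apply/eqP; rewrite -[RHS]sv; congr (_ + _).
  by apply: eq_bigl => i; rewrite -val_eqE /= inordK.
by rewrite -[29%N]/(28 + 1)%N natrD; ring.
Qed.

(** Frobenius fixes [u] and multiplies the exponents of [eta] by p, that is by 2^m, which shifts the
    discrete logarithm by m. *)
Lemma gauss_frobenius p u m : p \in [pchar F] -> u ^+ 28 = 1 -> u ^+ p = u ->
  p = pow2_29 m %[mod 29] -> u ^+ m * gauss u ^+ p = gauss u.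
Proof.
move=> hp hu up hm.
rewrite -(pFrobenius_autE hp) /gauss raddf_sum mulr_sumr.
rewrite -[RHS](sum_shift _ _ _ m (gauss_period _ hu)).
apply: eq_bigr => k _ /=; rewrite rmorphM !rmorphXn /= !pFrobenius_autE up.
rewrite mulrA -exprD addnC -exprM; congr (_ * _); apply: eta_expr_mod.
by rewrite -pow2_29D -modnMml hm modnMml mulnC.
Qed.

Section SeventhRootSum.
Context {w : F}.
Hypothesis phi7w : phi7 w = 0.

Lemma phi7_expr28 : w ^+ 28 = 1.
Proof. by rewrite (phi7_expr_mod phi7w). Qed.

(** The geometric sum in [gauss_mul] vanishes here; what remains is the factorization of the Jacobi
    sum of [w] with itself. *)
Lemma gauss_sq : gauss w ^+ 2 =
  - w ^+ 6 * pi29 (w ^+ 2) * pi29 (w ^+ 4) * pi29 (w ^+ 6) * gauss (w ^+ 2).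
Proof.
rewrite expr2 gauss_mul ?phi7_expr28 // -expr2.
have -> : \sum_(j < 28) (w ^+ 2) ^+ j = 0.
  have := phi7_expr phi7w 2 isT; set x := w ^+ 2 => hx.
  rewrite !big_ord_recr big_ord0 /= add0r.
  by rewrite -[RHS](mul0r (1 + x ^+ 7 + x ^+ 14 + x ^+ 21)) -hx /phi7; ring.
rewrite mulr0 addr0; congr (_ * _).
have -> : \sum_(m < 28 | m != 14 :> nat) w ^+ m * (w ^+ 2) ^+ (28 - zech m)
  = \sum_(a <- [seq ((m + 2 * (28 - zech m)) %% 7)%N | m <- iota 0 28 & m != 14%N])
      w ^+ a.
  rewrite big_map big_filter -[X in iota 0 X]subn0 -/(index_iota 0 28) big_mkord.
  by apply: eq_bigr => m _; rewrite -exprM -exprD (phi7_expr_mod phi7w).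
set s := map _ _.
(* The exponents modulo 7 of the 27 terms of the Jacobi sum, with multiplicities; 2 does not
   occur. *)
rewrite (perm_big (nseq 4 0 ++ nseq 4 1 ++ nseq 4 3 ++ nseq 6 4 ++ nseq 3 5 ++ nseq 6 6)%N);
  last by vm_compute.
rewrite /= !big_cons big_nil addr0 !(pi29_expr_mod phi7w) /=.
apply/eqP; rewrite -subr_eq0; apply/eqP.
(* The polynomial is the multiplier of [phi7 w] in the difference of the two sides. *)
rewrite -[RHS](mul0r (
  4 - 4 * w ^+ 2 + 4 * w ^+ 3 + 2 * w ^+ 4 - 3 * w ^+ 5 + 4 * w ^+ 6 - 2 *
  w ^+ 7 - w ^+ 8 - 2 * w ^+ 9 + w ^+ 10 + 2 * w ^+ 11 - w ^+ 12))
  -phi7w /phi7.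
ring.
Qed.

Lemma gauss_neq0 : 29%:R != 0 :> F -> gauss w != 0.
Proof.
move=> nz; have : gauss (w ^+ 6) * gauss w != 0.
  rewrite gauss_mul_inv ?phi7_expr28 //.
  - by rewrite (phi7_expr_mod phi7w) mulr1.
  - by rewrite -exprSr (phi7_expr7 phi7w).
  - rewrite !big_ord_recr big_ord0 /= add0r.
    by rewrite -[RHS](mul0r (1 + w ^+ 7 + w ^+ 14 + w ^+ 21)) -phi7w /phi7; ring.
by rewrite mulf_eq0 negb_or => /andP[].
Qed.

End SeventhRootSum.
End GaussSum.

(** * Powers of alpha in prime characteristic *)

(** This is gamma. As a rational expression in [w], it is fixed by Frobenius in characteristic p
    congruent to 1 modulo 7, whence its power p - 1 is 1. *)
Definition cofactor29 {F : fieldType} (w : F) : F :=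
  pi29 (w ^+ 2) ^+ 2 * pi29 (w ^+ 4) ^+ 3 * pi29 (w ^+ 6)
  / (pi29 (w ^+ 3) ^+ 2 * pi29 (w ^+ 5)).

Lemma rmorph_pi29 {F K : fieldType} (f : {rmorphism F -> K}) x :
  f (pi29 x) = pi29 (f x).
Proof. by rewrite /pi29 rmorphD rmorphB rmorph1 rmorphXn. Qed.

Lemma rmorph_alpha29 {F K : fieldType} (f : {rmorphism F -> K}) x :
  f (alpha29 x) = alpha29 (f x).
Proof.
by rewrite /alpha29 fmorph_div !rmorphM !(rmorphXn, rmorph_pi29).
Qed.

Lemma rmorph_cofactor29 {F K : fieldType} (f : {rmorphism F -> K}) x :
  f (cofactor29 x) = cofactor29 (f x).
Proof.
by rewrite /cofactor29 fmorph_div !rmorphM !(rmorphXn, rmorph_pi29).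
Qed.

Section Power.
Context {F : fieldType} {w : F}.
Hypothesis phi7w : phi7 w = 0.
Hypothesis nz29 : 29%:R != 0 :> F.

Lemma alpha29_cofactor : alpha29 w * cofactor29 w ^+ 2 = 29%:R.
Proof.
have /and5P[? ? ? ? /andP[? ?]] := pi29_neq0 phi7w nz29.
rewrite -(pi29_norm phi7w) /alpha29 /cofactor29; field.
by do ?[apply/andP; split].
Qed.

Section WithEta.
Context {eta : F}.
Hypothesis eta_sum : \sum_(i < 29) eta ^+ i = 0.

Let G := @gauss F eta.

(** Doubling permutes [w], [w ^+ 2], [w ^+ 4] cyclically, so three squarings give the eighth power
    of [G w] as a multiple of [G w], which can be cancelled. *)
Lemma gauss_expr7 : G w ^+ 7 = - w ^+ 2 * alpha29 w ^+ 3 * cofactor29 w ^+ 7.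
Proof.
have phi2 := phi7_expr phi7w 2 isT; have phi4 := phi7_expr phi7w 4 isT.
have E c m : pi29 (w ^+ c ^+ m) = pi29 (w ^+ (c * m %% 7)).
  by rewrite -exprM (phi7_expr_mod phi7w).
have h1 := gauss_sq eta_sum phi7w.
have h2 := gauss_sq eta_sum phi2.
have := gauss_sq eta_sum phi4.
rewrite -(exprM w 4 2) (phi7_expr_mod phi7w (4 * 2)) /= expr1 => h4.
rewrite -(exprM w 2 2) in h2.
rewrite !E /= expr1 in h2 h4.
have /and5P[? ? ? ? /andP[? ?]] := pi29_neq0 phi7w nz29.
apply: (mulIf (gauss_neq0 eta_sum phi7w nz29)); rewrite -exprSr.
rewrite -[8%N]/(2 * 4)%N exprM h1 exprMn (exprM _ 2 2 : @gauss F eta (w ^+ 2) ^+ 4 = _) h2.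
rewrite [(_ * gauss _) ^+ 2]exprMn h4.
(* The units [- w ^+ 6], [- w ^+ 12], [- w ^+ 24] of the three squarings enter with exponents 4, 2,
   1. *)
have w72 : w ^+ 72 = w ^+ 2 by rewrite (phi7_expr_mod phi7w).
rewrite -[- w ^+ 2 in RHS](congr1 -%R w72) /alpha29 /cofactor29 /G; field.
by do ?[apply/andP; split].
Qed.

(** The Gauss sum of order 7 determines alpha^(6N), the quadratic one determines alpha^(7N), and
    their quotient is alpha^N. *)
Lemma alpha29_unity p N m : p \in [pchar F] -> p = (14 * N + 1)%N -> (7 %| N)%N ->
  p = pow2_29 m %[mod 29] -> alpha29 w ^+ N = (- w) ^+ m.
Proof.
move=> hp pN N7 hm.
have wp : w ^+ p = w.
  by rewrite (phi7_expr_mod phi7w) (_ : p %% 7 = 1)%N //; lia.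
have cp : cofactor29 w ^+ (14 * N) = 1.
  have c0 : cofactor29 w != 0.
    have := nz29; rewrite -alpha29_cofactor mulf_eq0 negb_or => /andP[_].
    by rewrite expf_eq0.
  apply: (mulIf c0); rewrite mul1r -exprSr -addn1 -pN.
  by rewrite -(pFrobenius_autE hp) rmorph_cofactor29 /= pFrobenius_autE wp.
(* Frobenius applied to [G w], with G^(14N) expanded as the power 2N of [gauss_expr7]. *)
have key1 : w ^+ m * alpha29 w ^+ (6 * N) = 1.
  have G0 : G w != 0 by exact: gauss_neq0.
  have w28 : w ^+ 28 = 1 by exact: phi7_expr28.
  apply: (mulIf G0); rewrite mul1r -[RHS](gauss_frobenius eta_sum _ _ _ hp w28 wp hm).
  rewrite pN exprD expr1 mulrA; congr (_ * _ * _).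
  have expand (a b c : F) :
      (a * b ^+ 3 * c ^+ 7) ^+ (2 * N) = a ^+ (2 * N) * b ^+ (6 * N) * c ^+ (14 * N).
    by rewrite (exprMn _ (a * b ^+ 3)) (exprMn _ a) -!exprM !mulnA.
  rewrite -[14%N]/(7 * 2)%N -mulnA [RHS]exprM -/(G w) gauss_expr7 expand cp mulr1.
  rewrite [(- w ^+ 2) ^+ _]exprM sqrrN -!exprM (phi7_expr_mod phi7w) (_ : _ %% 7 = 0)%N ?mul1r //.
  by lia.
(* Quadratic reciprocity for 29: the quadratic Gauss sum squares to 29 and Frobenius multiplies it
   by (-1)^m. *)
have key2 : 29%:R ^+ (7 * N) = (-1) ^+ m :> F.
  have s28 : (-1) ^+ 28 = 1 :> F by rewrite -signr_odd.
  have s0 : \sum_(j < 28) (-1) ^+ j = 0 :> F.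
    by rewrite !big_ord_recr big_ord0 /=; ring.
  have sp : (-1) ^+ p = -1 :> F.
    by rewrite -signr_odd (_ : odd p) // pN oddD oddM.
  have G2 : G (-1) ^+ 2 = 29%:R.
    rewrite expr2 (gauss_mul_inv eta_sum) ?mulrNN ?mulr1 // -signr_odd.
    by rewrite mulr1.
  have G0 : G (-1) != 0.
    by have := nz29; rewrite -G2 expf_eq0.
  have := gauss_frobenius eta_sum _ _ _ hp s28 sp hm.
  rewrite pN exprD expr1 -[14%N]/(2 * 7)%N -mulnA exprM -/(G (-1)) G2 mulrA.
  rewrite -[RHS]mul1r => /(mulIf G0) e.
  by rewrite -[RHS]mulr1 -[X in _ = _ * X]e mulrA -expr2 sqrr_sign mul1r.
have key3 : alpha29 w ^+ (7 * N) = (-1) ^+ m.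
  by rewrite -key2 -alpha29_cofactor (exprMn _ (alpha29 w)) -exprM mulnA cp mulr1.
rewrite exprNn -key3 -[LHS]mulr1 -key1 mulrCA -exprD mulrC.
by congr (alpha29 w ^+ _ * _); lia.
Qed.

End WithEta.
End Power.

(** * Galois invariant integer polynomials across fields *)

Lemma phi7_expr_neq1 {F : fieldType} {w : F} c :
  phi7 w = 0 -> 7%:R != 0 :> F -> ~~ (7 %| c)%N -> w ^+ c != 1.
Proof.
move=> hw nz7 hc; apply: contraNneq nz7 => wc1.
have := phi7_expr hw c hc; rewrite wc1 /phi7 => <-; apply/eqP; ring.
Qed.

Lemma intr_eq0_pchar0 {F : fieldType} (m : int) :
  [pchar F] =i pred0 -> (m%:~R == 0 :> F) = (m == 0).
Proof.
move=> F0; case: m => n; first by rewrite -pmulrn ((pcharf0P F).1 F0).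
by rewrite NegzE mulrNz !oppr_eq0 -pmulrn ((pcharf0P F).1 F0).
Qed.

Definition int_eval {F : fieldType} (w : F) (f : {poly int}) : F :=
  (map_poly intr f).[w].

Lemma int_evalM {F : fieldType} (w : F) f g :
  int_eval w (f * g) = int_eval w f * int_eval w g.
Proof. by rewrite /int_eval rmorphM hornerM. Qed.

Lemma int_evalD {F : fieldType} (w : F) f g :
  int_eval w (f + g) = int_eval w f + int_eval w g.
Proof. by rewrite /int_eval rmorphD hornerD. Qed.

Lemma int_evalX {F : fieldType} (w : F) f k : int_eval w (f ^+ k) = int_eval w f ^+ k.
Proof. by rewrite /int_eval rmorphXn horner_exp. Qed.

Lemma int_eval_comp {F : fieldType} (w : F) f k :
  int_eval w (f \Po 'X^k) = int_eval (w ^+ k) f.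
Proof. by rewrite /int_eval map_comp_poly map_polyXn horner_comp hornerXn. Qed.

Lemma int_eval_C {F : fieldType} (w : F) c : int_eval w c%:P = c%:~R.
Proof. by rewrite /int_eval map_polyC hornerC. Qed.

Definition phi7_poly : {poly int} := \poly_(i < 7) 1.

Lemma int_eval_phi7 {F : fieldType} (w : F) : int_eval w phi7_poly = phi7 w.
Proof.
rewrite /int_eval /phi7_poly poly_def raddf_sum horner_sum !big_ord_recl big_ord0.
rewrite /= !scale1r !map_polyXn !hornerXn /phi7 /bump /=; ring.
Qed.

(** The remainder modulo [phi7_poly] has degree at most 5 and takes a single value at the six
    distinct powers of [z], so it is a constant. Its coefficient is then the value in every
    field. *)
Lemma galois_invariant_const {F : fieldType} {z : F} (f : {poly int}) :
    [pchar F] =i pred0 -> phi7 z = 0 ->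
    (forall c, (0 < c < 7)%N -> int_eval (z ^+ c) f = int_eval z f) ->
  exists m : int, forall (K : fieldType) (w : K), phi7 w = 0 -> int_eval w f = m%:~R.
Proof.
move=> F0 hz hf.
have nz7 : 7%:R != 0 :> F by rewrite ((pcharf0P F).1 F0).
have monPhi : phi7_poly \is monic.
  by rewrite monicE lead_coefE size_poly_eq ?coef_poly // oner_eq0.
have szPhi : size phi7_poly = 7%N by rewrite size_poly_eq // oner_eq0.
have fE := Pdiv.RingMonic.rdivp_eq monPhi f.
set g := Pdiv.Ring.rmodp f phi7_poly in fE.
have szg : (size g <= 6)%N.
  by rewrite -ltnS -szPhi Pdiv.Ring.ltn_rmodpN0 ?monic_neq0.
have evE (K : fieldType) (w : K) : phi7 w = 0 -> int_eval w f = int_eval w g.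
  by move=> hw; rewrite fE int_evalD int_evalM int_eval_phi7 hw mulr0 add0r.
have g0 : map_poly intr g - (int_eval z g)%:P = 0 :> {poly F}.
  apply: (@roots_geq_poly_eq0 _ _ [seq z ^+ c | c <- iota 1 6]).
  - apply/allP => _ /mapP[c hc ->]; rewrite mem_iota in hc.
    rewrite /root !hornerE subr_eq0 -/(int_eval _ _) -!evE ?hf //.
    by apply: phi7_expr => //; lia.
  - rewrite map_inj_in_uniq ?iota_uniq // => i j.
    rewrite !mem_iota; wlog le_ij : i j / (i <= j)%N.
      by move=> h hi hj e; case/orP: (leq_total i j) => ?; [|apply/esym]; apply: h.
    move=> hi hj e; apply/eqP; rewrite eqn_leq le_ij leqNgt; apply/negP=> lt_ij.
    have: z ^+ (j - i) != 1 by apply: phi7_expr_neq1 => //; lia.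
    move/eqP; apply; apply: (mulfI (expf_neq0 i (phi7_neq0 hz))).
    by rewrite -exprD subnKC // mulr1.
  rewrite size_map size_iota (leq_trans (size_polyD _ _)) // geq_max size_polyN.
  by rewrite (leq_trans (size_poly _ _)) ?(leq_trans (size_polyC_leq1 _)).
exists g`_0 => K w hw; rewrite evE //.
suff -> : g = (g`_0)%:P by rewrite int_eval_C coefC.
apply/polyP => i; rewrite coefC; case: eqP => [->//|/eqP i0].
move/(congr1 (fun p : {poly F} => p`_i)): g0.
rewrite coefB coefC (negPf i0) subr0 coef0 coef_map /= => /eqP.
by rewrite intr_eq0_pchar0 // => /eqP.
Qed.


(** * Symmetric functions of the half traces *)

Definition half_trace {F : fieldType} (N : nat) (w : F) : F :=
  alpha29 w ^+ N + alpha29 (w ^+ 6) ^+ N.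

Definition sym1 {F : fieldType} (N : nat) (w : F) : F :=
  half_trace N w + half_trace N (w ^+ 3) + half_trace N (w ^+ 5).

Definition sym2 {F : fieldType} (N : nat) (w : F) : F :=
  half_trace N w * half_trace N (w ^+ 3) + half_trace N w * half_trace N (w ^+ 5)
  + half_trace N (w ^+ 3) * half_trace N (w ^+ 5).

Definition sym3 {F : fieldType} (N : nat) (w : F) : F :=
  half_trace N w * half_trace N (w ^+ 3) * half_trace N (w ^+ 5).

Section Symmetry.
Context {F : fieldType} {w : F}.
Hypothesis phi7w : phi7 w = 0.

Lemma half_trace_mod N c : half_trace N (w ^+ c) = half_trace N (w ^+ (c %% 7)).
Proof. by rewrite (phi7_expr_mod phi7w). Qed.

Lemma half_trace_conj N c : half_trace N (w ^+ c ^+ 6) = half_trace N (w ^+ c).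
Proof.
rewrite /half_trace addrC; congr (alpha29 _ ^+ _ + _).
by rewrite -!exprM (phi7_expr_mod phi7w) [in RHS](phi7_expr_mod phi7w); congr (w ^+ _); lia.
Qed.

Lemma half_traceN N c d : (c + d = 0 %[mod 7])%N ->
  half_trace N (w ^+ c) = half_trace N (w ^+ d).
Proof.
move=> h; rewrite -(half_trace_conj N d) -exprM half_trace_mod [RHS]half_trace_mod.
by congr (half_trace N (w ^+ _)); lia.
Qed.

(** A half trace depends only on the exponent modulo 7 up to sign; 1, 3, 5 represent the three
    classes, and multiplication by c permutes them. *)
Lemma sym_invariant N c : (0 < c < 7)%N ->
  [/\ sym1 N (w ^+ c) = sym1 N w, sym2 N (w ^+ c) = sym2 N w
    & sym3 N (w ^+ c) = sym3 N w].
Proof.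
have e1 : half_trace N w = half_trace N (w ^+ 1) by rewrite expr1.
rewrite /sym1 /sym2 /sym3 e1 -!exprM.
have e6 : half_trace N (w ^+ 6) = half_trace N (w ^+ 1) by exact: half_traceN.
have e4 : half_trace N (w ^+ 4) = half_trace N (w ^+ 3) by exact: half_traceN.
have e2 : half_trace N (w ^+ 2) = half_trace N (w ^+ 5) by exact: half_traceN.
rewrite (half_trace_mod _ c) (half_trace_mod _ (c * 3)) (half_trace_mod _ (c * 5)).
by case: c => [|[|[|[|[|[|[|c]]]]]]] // _; rewrite /= ?(e6, e4, e2) //; split; ring.
Qed.

End Symmetry.

Definition pi29_poly (c : nat) : {poly int} := 1 - 'X^c + 'X^(4 * c).

(** Each of the 1 + 3 + 5 = 9 factors in the denominator of alpha is traded for the product of the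
    five other conjugates of pi, at the price of a factor 29. *)
Definition alpha29_numer : {poly int} :=
  let p := pi29_poly in
  p 1%N * p 5%N ^+ 3 * p 3%N ^+ 5
  * (p 1%N * p 2%N * p 3%N * p 4%N * p 5%N)
  * (p 1%N * p 3%N * p 4%N * p 5%N * p 6%N) ^+ 3
  * (p 1%N * p 2%N * p 3%N * p 5%N * p 6%N) ^+ 5.

Lemma int_eval_pi29 {F : fieldType} (w : F) c :
  int_eval w (pi29_poly c) = pi29 (w ^+ c).
Proof.
rewrite /int_eval /pi29_poly rmorphD rmorphB rmorph1 /= !map_polyXn.
by rewrite !hornerE /pi29 -exprM mulnC.
Qed.

Lemma int_eval_alpha29 {F : fieldType} (w : F) : phi7 w = 0 -> 29%:R != 0 :> F ->
  int_eval w alpha29_numer = 29%:R ^+ 9 * alpha29 w.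
Proof.
move=> hw nz; have /and5P[? ? ? ? /andP[? ?]] := pi29_neq0 hw nz.
rewrite /alpha29_numer !(int_evalM, int_evalX) !int_eval_pi29 expr1.
rewrite -(pi29_norm hw) /alpha29; field.
by do ?[apply/andP; split].
Qed.

Lemma closed_geometric_root (K : closedFieldType) n :
  exists x : K, \sum_(i < n.+2) x ^+ i = 0.
Proof.
have /closed_rootP[x /rootP hx] : size (\poly_(i < n.+2) 1 : {poly K}) != 1%N.
  by rewrite size_poly_eq // oner_eq0.
exists x; rewrite -[RHS]hx horner_poly.
by apply: eq_bigr => i _; rewrite mul1r.
Qed.

(** The symmetric functions have degrees 1, 2, 3 in the half traces, each of which needs 29^(9N) to
    become an integer polynomial in [w]. The integers are found over [algC] and serve in all fields
    at once. *)
Lemma sym_integral N : exists m : int * int * int,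
  forall (F : fieldType) (w : F), phi7 w = 0 -> 29%:R != 0 :> F ->
  [/\ m.1.1%:~R = 29%:R ^+ (9 * N) * sym1 N w,
      m.1.2%:~R = 29%:R ^+ (18 * N) * sym2 N w
    & m.2%:~R = 29%:R ^+ (27 * N) * sym3 N w].
Proof.
pose h : {poly int} := alpha29_numer ^+ N + (alpha29_numer \Po 'X^6) ^+ N.
have hE (F : fieldType) (w : F) c : phi7 w = 0 -> 29%:R != 0 :> F -> ~~ (7 %| c)%N ->
    int_eval w (h \Po 'X^c) = 29%:R ^+ (9 * N) * half_trace N (w ^+ c).
  move=> hw nz hc; rewrite int_eval_comp int_evalD !int_evalX int_eval_comp.
  have hwc := phi7_expr hw c hc.
  have hwc6 := phi7_expr hwc 6 isT.
  by rewrite !int_eval_alpha29 // !(exprMn _ (29%:R ^+ 9)) -(exprM _ 9 N) mulrDr.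
pose a := h \Po 'X^1; pose b := h \Po 'X^3; pose c := h \Po 'X^5.
have E (F : fieldType) (w : F) : phi7 w = 0 -> 29%:R != 0 :> F ->
    [/\ int_eval w (a + b + c) = 29%:R ^+ (9 * N) * sym1 N w,
        int_eval w (a * b + a * c + b * c) = 29%:R ^+ (18 * N) * sym2 N w
      & int_eval w (a * b * c) = 29%:R ^+ (27 * N) * sym3 N w].
  move=> hw nz; rewrite !(int_evalD, int_evalM) !hE // expr1.
  rewrite (_ : (18 * N = 9 * N + 9 * N)%N); last by lia.
  rewrite (_ : (27 * N = 9 * N + 9 * N + 9 * N)%N); last by lia.
  by rewrite !exprD /sym1 /sym2 /sym3; split; ring.
have [z hz] : exists z : algC, phi7 z = 0.
  have [z hz] := closed_geometric_root algC 5.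
  by exists z; rewrite -[RHS]hz !big_ord_recr big_ord0 /phi7 /=; ring.
have nz29 : 29%:R != 0 :> algC by rewrite pnatr_eq0.
have C0 : [pchar algC] =i pred0 by exact: pchar_num.
have cst (f : {poly int}) := galois_invariant_const f C0 hz.
have inv k : (0 < k < 7)%N ->
    [/\ int_eval (z ^+ k) (a + b + c) = int_eval z (a + b + c),
        int_eval (z ^+ k) (a * b + a * c + b * c) = int_eval z (a * b + a * c + b * c)
      & int_eval (z ^+ k) (a * b * c) = int_eval z (a * b * c)].
  move=> hk; have [i1 i2 i3] := sym_invariant hz N k hk.
  have hzk : phi7 (z ^+ k) = 0 by apply: phi7_expr => //; lia.
  by have [-> -> ->] := E _ _ hz nz29; have [-> -> ->] := E _ _ hzk nz29; rewrite i1 i2 i3.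
have [|m1 h1] := cst (a + b + c); first by move=> k /inv[].
have [|m2 h2] := cst (a * b + a * c + b * c); first by move=> k /inv[].
have [|m3 h3] := cst (a * b * c); first by move=> k /inv[].
by exists (m1, m2, m3) => F w hw nz; have [<- <- <-] := E _ _ hw nz; rewrite h1 ?h2 ?h3.
Qed.

(** * The order of alpha in characteristic l *)

Lemma root_of_unity_closure p : prime p ->
  exists (K : fieldType) (w eta : K),
    [/\ p \in [pchar K], phi7 w = 0 & \sum_(i < 29) eta ^+ i = 0].
Proof.
move=> pp; have [K [/= f _]] := countable_algebraic_closure 'F_p.
have [w hw] := closed_geometric_root K 5.
have [eta heta] := closed_geometric_root K 27.
exists K, w, eta; split=> //; first exact/(rmorph_pchar f)/pchar_Fp.
by rewrite -[RHS]hw !big_ord_recr big_ord0 /phi7 /=; ring.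
Qed.

Section Order.
Context {F : fieldType} {w : F}.
Hypothesis phi7w : phi7 w = 0.
Hypothesis nz29 : 29%:R != 0 :> F.

(** Up to the sign, the half trace is a root of y^3 + y^2 - 2y - 1; substituting y = a + 1/a and
    multiplying by a^3 yields [phi7 a]. *)
Lemma phi7_alpha29_expr N (s : bool) : 
  sym1 N w = - (-1) ^+ s -> sym2 N w = - 2%:R -> sym3 N w = (-1) ^+ s ->
  phi7 ((-1) ^+ s * alpha29 w ^+ N) = 0.
Proof.
move=> e1 e2 e3; set a := alpha29 w ^+ N.
have a0 : a != 0 by rewrite expf_neq0 // alpha29_neq0.
have hy : half_trace N w = a + a^-1.
  by rewrite /half_trace alpha29_conj // exprVn.
have : half_trace N w ^+ 3 - sym1 N w * half_trace N w ^+ 2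
       + sym2 N w * half_trace N w - sym3 N w = 0.
  by rewrite /sym1 /sym2 /sym3; ring.
rewrite e1 e2 e3 hy => h.
rewrite -[RHS](mulr0 (a ^+ 3)) -h /phi7.
by case: s {e1 e2 e3 h}; rewrite ?expr0 ?expr1; field.
Qed.

(** Six iterations of Frobenius fix [w], because l^6 is 1 modulo 7, hence they fix alpha. *)
Lemma alpha29_expr_eq1 l : l \in [pchar F] -> ~~ (7 %| l)%N ->
  alpha29 w ^+ (l ^ 6).-1 = 1.
Proof.
move=> hl nl; have l0 : (0 < l)%N by rewrite lt0n; apply: contraNneq nl => ->.
have frob k : alpha29 w ^+ (l ^ k) = alpha29 (w ^+ (l ^ k)).
  elim: k => [|k IH]; first by rewrite expn0 !expr1.
  rewrite expnSr exprM IH -(pFrobenius_autE hl) rmorph_alpha29 /= pFrobenius_autE.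
  by rewrite -exprM.
apply: (mulIf (alpha29_neq0 phi7w nz29)).
rewrite mul1r -exprSr prednK ?expn_gt0 ?l0 // frob (phi7_expr_mod phi7w).
rewrite (_ : _ %% 7 = 1)%N // -modnXm.
have : (0 < l %% 7 < 7)%N by rewrite lt0n nl ltn_pmod.
by case: (l %% 7)%N => [|[|[|[|[|[|[|]]]]]]].
Qed.

(* [alpha29 w] has order dividing [14 ^ r] but not [2 * 14 ^ (r - 1)], so its
   order, which divides [l ^ 6 - 1], is a multiple of [7 ^ r]. *)
Lemma dvdn_expr7 l r (s : bool) : l \in [pchar F] -> ~~ (7 %| l)%N ->
  (0 < r)%N -> phi7 ((-1) ^+ s * alpha29 w ^+ (14 ^ r.-1)) = 0 ->
  (7 ^ r %| (l ^ 6).-1)%N.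
Proof.
move=> hl nl r0; set x := alpha29 w; set b := _ * _ => hb.
have nz7 : 7%:R != 0 :> F.
  rewrite -(dvdn_pcharf hl) dvdn_prime2 ?(pcharf_prime hl) //.
  by apply: contraNneq nl => ->.
have b7 := phi7_expr7 hb; have b2 := phi7_expr_neq1 2 hb nz7 isT.
have xe k : x ^+ (14 ^ r.-1) ^+ (2 * k) = b ^+ (2 * k).
  by rewrite /b (exprMn _ ((-1) ^+ s)) [((-1) ^+ s) ^+ _]exprM sqrr_sign expr1n mul1r.
have x14 : x ^+ (14 ^ r) = 1.
  by rewrite -[r]prednK // expnSr exprM (xe 7%N) mulnC exprM b7 expr1n.
have [m prim_m m14] : {m | m.-primitive_root x & (m %| 14 ^ r)%N}.
  by apply: prim_order_exists x14; rewrite expn_gt0.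
have mE : (m %| (l ^ 6).-1)%N.
  by rewrite (prim_order_dvd prim_m); apply/eqP; exact: alpha29_expr_eq1.
have m2 : ~~ (m %| 2 ^ r * 7 ^ r.-1)%N.
  rewrite -[in (2 ^ r)%N](prednK r0) expnS -mulnA -expnMn (prim_order_dvd prim_m).
  by rewrite mulnC exprM (xe 1%N).
(* The 7-part of [m] is 7^k; with k < r, [m] would divide 2^r 7^(r-1), against [m2]. *)
have /(dvdn_pfactor _ _ (isT : prime 7))[k kr g7] := dvdn_gcdr m (7 ^ r).
suff kE : k = r by rewrite (dvdn_trans _ mE) // -kE -g7 dvdn_gcdl.
apply/eqP; rewrite eqn_leq kr leqNgt; apply: contra m2 => ltkr.
rewrite (@dvdn_trans (2 ^ r * gcdn m (7 ^ r))) //; last first.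
  by rewrite dvdn_pmul2l ?expn_gt0 // g7 dvdn_exp2l // -ltnS prednK.
by rewrite muln_gcdr dvdn_gcd dvdn_mull // -expnMn.
Qed.

End Order.

(** * Gaussian periods and the case of prime characteristic M *)

(** These are the two-term Gaussian periods, with cubic y^3 + y^2 - 2y - 1; the explicit polynomials
    are multipliers of [phi7 b]. *)
Lemma period_sym {F : fieldType} {b : F} : phi7 b = 0 ->
  let y1 := b + b ^+ 6 in let y3 := b ^+ 3 + b ^+ 4 in let y5 := b ^+ 5 + b ^+ 2 in
  [/\ y1 + y3 + y5 = -1, y1 * y3 + y1 * y5 + y3 * y5 = - 2%:R & y1 * y3 * y5 = 1].
Proof.
move=> hb /=; split; apply/eqP; rewrite -subr_eq0; apply/eqP.
- by rewrite -[RHS]hb /phi7; ring.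
- rewrite -[RHS](mul0r (2 - 2 * b + b ^+ 3 + b ^+ 5)) -hb /phi7; ring.
- rewrite -[RHS](mul0r (- 1 + b + b ^+ 6 - b ^+ 7 + b ^+ 9)) -hb /phi7; ring.
Qed.

Section PrimeCharacteristic.
Context {F : fieldType} {w eta : F}.
Hypotheses (phi7w : phi7 w = 0) (eta_sum : \sum_(i < 29) eta ^+ i = 0).
Hypothesis nz29 : 29%:R != 0 :> F.

(** By [alpha29_unity] the half traces are (-1)^m times the periods of [w ^+ m], which remains a
    root of [phi7] since 7 does not divide m. *)
Lemma sym_prime p N m : p \in [pchar F] -> p = (14 * N + 1)%N -> (7 %| N)%N ->
    p = pow2_29 m %[mod 29] -> ~~ (7 %| m)%N ->
  [/\ sym1 N w = - (-1) ^+ m, sym2 N w = - 2%:R & sym3 N w = (-1) ^+ m].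
Proof.
move=> hp pN N7 hm nm.
have hb := phi7_expr phi7w m nm; set b := w ^+ m in hb.
have ht c : ~~ (7 %| c)%N ->
    half_trace N (w ^+ c) = (-1) ^+ m * (b ^+ c + b ^+ (6 * c)).
  move=> hc; have hwc := phi7_expr phi7w c hc.
  have hwc6 := phi7_expr hwc 6 isT.
  rewrite /half_trace !(alpha29_unity _ _ eta_sum p N m) //.
  rewrite (exprNn (w ^+ c)) (exprNn (w ^+ c ^+ 6)) mulrDr /b -!exprM.
  by congr (_ * w ^+ _ + _ * w ^+ _); lia.
have [] := period_sym hb.
rewrite /sym1 /sym2 /sym3 -[X in half_trace N X + _ + _](expr1 w).
have -> : half_trace N w = (-1) ^+ m * (b + b ^+ 6).
  by rewrite -[w]expr1 ht // expr1.
rewrite !ht // (phi7_expr_mod hb (6 * 3)) (phi7_expr_mod hb (6 * 5)) /= => e1 e2 e3.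
have t2 : (-1) ^+ m * (-1) ^+ m = 1 :> F by rewrite -expr2 sqrr_sign.
set t := (-1) ^+ m in t2 *.
split.
- by rewrite -(mulrN1 t) -e1; ring.
- by rewrite -e2 -[RHS]mul1r -t2; ring.
by rewrite -[RHS]mulr1 -e3 -[RHS]mul1r -t2; ring.
Qed.

End PrimeCharacteristic.

(** * Congruences between rationals with denominator prime to M *)

Lemma ratloc_frac (M D : nat) (m : int) :
  coprime D M -> (0 < D)%N -> m%:~R / D%:R \in ratloc M.
Proof.
move=> cDM D0; rewrite inE; set q : rat := _ / _.
apply: coprime_dvdl cDM; rewrite -(Gauss_dvdr _ (n := `|numq q|)); last first.
  by rewrite coprime_sym coprime_num_den.
have : numq q * D%:Z = m * denq q.
  apply: (intr_inj (R := rat)); rewrite !rmorphM /= numqE -pmulrn.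
  move: (denq q)%:~R => d; rewrite /q; field.
  by rewrite pnatr_eq0 -lt0n.
move=> /(congr1 absz); rewrite !abszM absz_nat => ->.
by rewrite dvdn_mull.
Qed.

(** Both [D] and the denominator of the quotient are prime to [M], so they can be cleared without
    affecting divisibility by [M]. *)
Lemma ratloc_congr_frac (M D : nat) (m e : int) : coprime D M -> (0 < D)%N ->
  ratloc_congr M (m%:~R / D%:R) e%:~R <-> (M%:Z %| m - e * D%:Z)%Z.
Proof.
move=> cDM D0; have Dn0 : D%:R != 0 :> rat by rewrite pnatr_eq0 -lt0n.
split=> [[_ _ [q qM eq]]|/dvdzP[k ek]].
  have : (M%:Z %| (m - e * D%:Z) * denq q)%Z.
    apply/dvdzP; exists (numq q * D%:Z); apply: (intr_inj (R := rat)).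
    rewrite !(rmorphM, rmorphB) /= numqE -!pmulrn.
    have -> : m%:~R = (m%:~R / D%:R - e%:~R) * D%:R + e%:~R * D%:R :> rat by field.
    by rewrite eq; ring.
  by rewrite mulrC Gauss_dvdzr // coprimez_sym /coprimez; move: qM; rewrite inE /coprime /gcdz => /eqP ->.
split; first exact: ratloc_frac.
  by rewrite -[e%:~R]divr1 -[1]/(1%:R); apply: ratloc_frac => //; exact: coprime1n.
exists (k%:~R / D%:R); first exact: ratloc_frac.
have -> : m = k * M%:Z + e * D%:Z by rewrite -ek subrK.
by rewrite rmorphD !rmorphM /= -!pmulrn; field.
Qed.

Lemma congr_modQ_frac (L : splittingFieldType rat) (M D : nat) (m e : int) (x : L) :
    coprime D M -> (0 < D)%N -> m%:~R = D%:R * x ->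
  congr_modQ M x e <-> (M%:Z %| m - e * D%:Z)%Z.
Proof.
move=> cDM D0 mx; rewrite -(ratloc_congr_frac _ _ _ _ cDM D0).
have xE : x = (m%:~R / D%:R)%:A.
  have nz : D%:R != 0 :> rat by rewrite pnatr_eq0 -lt0n.
  have -> : (m%:~R / D%:R)%:A = (in_alg L m%:~R) / (in_alg L D%:R) by rewrite -fmorph_div.
  rewrite rmorph_int rmorph_nat mx mulrC mulKf //.
  by rewrite -(rmorph_nat (in_alg L)) fmorph_eq0.
split=> [[q]|h]; last by exists (m%:~R / D%:R).
by rewrite xE => /(fmorph_inj (in_alg L)) ->.
Qed.

(** * Complex roots of unity and exponents in the group ring *)

Lemma zetaX (R : realType) m k :
  zeta R m ^+ k = Complex (cos (2 * pi / m%:R *+ k)) (sin (2 * pi / m%:R *+ k)).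
Proof.
elim: k => [|k IH]; first by rewrite expr0 mulr0n cos0 sin0.
rewrite exprS IH (mulrS (2 * pi / _)) cosD sinD; apply/eqP; rewrite eq_complex /=.
by rewrite !eqxx /= addrC.
Qed.

Lemma zeta_norm (R : realType) m : (zeta R m)^* * zeta R m = 1.
Proof.
apply/eqP; rewrite eq_complex /=; apply/andP; split; apply/eqP.
  by rewrite mulNr opprK -!expr2 cos2Dsin2.
by ring.
Qed.

Lemma zeta7_expr7 (R : realType) : zeta R 7 ^+ 7 = 1.
Proof.
rewrite zetaX -mulr_natr mulfVK ?pnatr_eq0 // mulrC mulr_natr cos2pi sin2pi //.
Qed.

Lemma zeta7_phi7 (R : realType) : phi7 (zeta R 7) = 0.
Proof.
have n1 : zeta R 7 - 1 != 0.
  rewrite subr_eq0 eq_complex /= negb_and orbC gt_eqF // sin_gt0_pi //.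
  by have := pi_gt0 R; move: pi => x x0; apply/andP; split; lra.
apply: (mulfI n1); rewrite mulr0.
have -> : (zeta R 7 - 1) * phi7 (zeta R 7) = zeta R 7 ^+ 7 - 1 by rewrite /phi7; ring.
by rewrite zeta7_expr7 subrr.
Qed.

Lemma zeta14_sq (R : realType) : zeta R 14 ^+ 2 = zeta R 7.
Proof.
rewrite zetaX /zeta; have -> // : 2 * pi / 14 *+ 2 = 2 * pi / 7 :> R by field.
Qed.

Lemma rmorph_phi7 {F K : fieldType} (f : {rmorphism F -> K}) x :
  f (phi7 x) = phi7 (f x).
Proof. by rewrite /phi7 !rmorphD rmorph1 !rmorphXn. Qed.

Lemma rmorph_half_trace {F K : fieldType} (f : {rmorphism F -> K}) N x :
  f (half_trace N x) = half_trace N (f x).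
Proof. by rewrite /half_trace rmorphD !rmorphXn !rmorph_alpha29 rmorphXn. Qed.

Section GalPow.
Context {L : splittingFieldType rat} {x : L}.
Hypothesis x0 : x != 0.

Lemma galZ_powD (t u : galZ L) : galZ_pow x (t + u) = galZ_pow x t * galZ_pow x u.
Proof.
rewrite /galZ_pow -big_split; apply: eq_bigr => s _ /=.
by rewrite ffunE expfzDr // fmorph_eq0.
Qed.

Lemma galZ_powMn (t : galZ L) k : galZ_pow x (t *+ k) = galZ_pow x t ^+ k.
Proof.
elim: k => [|k IH]; last by rewrite mulrS galZ_powD IH exprS.
by rewrite expr0 /galZ_pow big1 // => s _; rewrite mulr0n ffunE.
Qed.

Lemma galZ_pow_elt (s : gal_of {:L}) : s \in 'Gal({:L} / 1)%g ->
  galZ_pow x (galZ_elt s) = s x.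
Proof.
move=> hs; rewrite /galZ_pow (bigD1 s) //= ffunE eqxx big1 ?mulr1 //.
by move=> t /andP[_ /negPf ts]; rewrite ffunE ts.
Qed.

End GalPow.

(** * The primality criterion in terms of integers *)

(** Modulo 29, 14^4 is 20 and squaring permutes 7, 20, 23 cyclically. *)
Lemma fermat29_residue n : (1 < n)%N ->
  ((14 ^ 2 ^ n + 1) %% 29)%N \in [:: 8; 21; 24]%N.
Proof.
move=> n1; have : ((14 ^ 2 ^ n) %% 29)%N \in [:: 7; 20; 23]%N.
  elim: n n1 => // -[|[|n]] // IH _; rewrite expnS mulnC expnM -modnXm.
  by have := IH isT; rewrite !inE => /or3P[] /eqP ->.
by rewrite -modnDml !inE => /or3P[] /eqP ->.
Qed.

(* The sign [e = (-1) ^ s] separates the two cases of the theorem. *)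
Definition sym_congr (M N : nat) (m : int * int * int) (e : int) : Prop :=
  [/\ (M%:Z %| m.1.1 - (- e) * (29 ^ (9 * N))%N%:Z)%Z,
      (M%:Z %| m.1.2 - (- 2) * (29 ^ (18 * N))%N%:Z)%Z
    & (M%:Z %| m.2 - e * (29 ^ (27 * N))%N%:Z)%Z].

Section Criterion.
Variables (r M N : nat) (m : int * int * int).
Hypotheses (r_gt1 : (1 < r)%N) (ME : M = (14 ^ r + 1)%N) (NE : N = (14 ^ r.-1)%N).
Hypothesis mP : forall (F : fieldType) (w : F), phi7 w = 0 -> 29%:R != 0 :> F ->
  [/\ m.1.1%:~R = 29%:R ^+ (9 * N) * sym1 N w,
      m.1.2%:~R = 29%:R ^+ (18 * N) * sym2 N w
    & m.2%:~R = 29%:R ^+ (27 * N) * sym3 N w].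
Hypothesis M29 : ~~ (29 %| M)%N.

Lemma intr_pchar_eq0 {F : fieldType} l (k : int) : l \in [pchar F] ->
  (k%:~R == 0 :> F) = (l%:Z %| k)%Z.
Proof.
move=> hl; case: (intP k) => [|j|j]; rewrite ?dvdz0 ?eqxx //.
  by rewrite -pmulrn -(dvdn_pcharf hl).
by rewrite mulrNz oppr_eq0 -pmulrn -(dvdn_pcharf hl) dvdzE abszN.
Qed.

Lemma M14N : M = (14 * N + 1)%N.
Proof. by rewrite ME NE -expnS prednK // ltnW. Qed.

Lemma N7 : (7 %| N)%N.
Proof.
rewrite NE -(prednK (_ : 0 < r.-1)%N); first by rewrite expnS -[14%N]/(7 * 2)%N -mulnA dvdn_mulr.
by rewrite -ltnS prednK // ltnW.
Qed.

(** The power of 29 is invertible in characteristic l, so a congruence modulo l of integers is an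
    equation for the symmetric function itself. *)
Lemma frac_transfer {F : fieldType} l (a e : int) k (y : F) :
  l \in [pchar F] -> 29%:R != 0 :> F -> a%:~R = 29%:R ^+ k * y ->
  (l%:Z %| a - e * (29 ^ k)%N%:Z)%Z <-> y = e%:~R.
Proof.
move=> hl nz aE; rewrite -(intr_pchar_eq0 _ _ hl) rmorphB rmorphM /= aE -pmulrn natrX.
rewrite (mulrC e%:~R) -mulrBr mulf_eq0 expf_eq0 (negPf nz) andbF /= subr_eq0.
by split=> [/eqP|->].
Qed.

Lemma prime_sym_congr k : prime M -> M = pow2_29 k %[mod 29] -> ~~ (7 %| k)%N ->
  sym_congr M N m ((-1) ^+ k).
Proof.
move=> pM hk nk; have [K [w [eta [hM hw heta]]]] := root_of_unity_closure M pM.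
have nz : 29%:R != 0 :> K.
  rewrite -(dvdn_pcharf hM) dvdn_prime2 //; apply: contraNneq M29 => ->.
  exact: dvdnn.
have [m1 m2 m3] := mP _ _ hw nz.
have [e1 e2 e3] := sym_prime hw heta nz M N k hM M14N N7 hk nk.
split.
- by apply/(frac_transfer M _ _ _ _ hM nz m1); rewrite e1 rmorphN rmorph_sign.
- by apply/(frac_transfer M _ _ _ _ hM nz m2); rewrite e2 rmorphN.
by apply/(frac_transfer M _ _ _ _ hM nz m3); rewrite e3 rmorph_sign.
Qed.

Lemma sym_congr_prime (s : bool) :
    (forall x : int, 1 < x -> x < 7 ^+ r ->
      (x ^+ 6 = 1 %[mod 7 ^+ r])%Z -> ~~ (x %| M%:Z)%Z) ->
  sym_congr M N m ((-1) ^+ s) -> prime M.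
Proof.
move=> hx [c1 c2 c3].
have M_gt1 : (1 < M)%N by rewrite ME addn1 ltnS expn_gt0.
set l := pdiv M; have pl : prime l := pdiv_prime M_gt1.
have lM : (l %| M)%N := pdiv_dvd M.
have l7 : ~~ (7 %| l)%N.
  apply/negP => h; have := dvdn_trans h lM; rewrite M14N dvdn_addr //.
  by rewrite -[14%N]/(7 * 2)%N -mulnA dvdn_mulr.
have [K [w [_ [hl hw _]]]] := root_of_unity_closure l pl.
have nz : 29%:R != 0 :> K.
  by rewrite -(dvdn_pcharf hl) dvdn_prime2 //; apply: contraNneq M29 => <-.
have lMz (k : int) : (M%:Z %| k)%Z -> (l%:Z %| k)%Z by apply: dvdz_trans.
have [m1 m2 m3] := mP _ _ hw nz.
move: c1 c2 c3 => /lMz /(frac_transfer l _ _ _ _ hl nz m1) c1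
  /lMz /(frac_transfer l _ _ _ _ hl nz m2) c2 /lMz /(frac_transfer l _ _ _ _ hl nz m3) c3.
rewrite ?(rmorphN, rmorph_sign) in c1 c2 c3.
have hphi := phi7_alpha29_expr hw nz N s c1 c2 c3; rewrite NE in hphi.
have h7 := dvdn_expr7 hw nz l r s hl l7 (ltnW r_gt1) hphi.
(* Otherwise [l] is one of the x excluded by [hx], since 7^r divides l^6 - 1. *)
have le_l : (7 ^ r <= l)%N.
  rewrite leqNgt; apply/negP => lt_l; have /negP[] : ~~ (l%:Z %| M%:Z)%Z; last by [].
  have E7 : 7 ^+ r = (7 ^ r)%N%:Z by rewrite -[RHS]natz natrX.
  apply: hx; first by rewrite -[1]/(1%N%:Z) ltz_nat prime_gt1.
    by rewrite E7 ltz_nat.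
  apply/eqP; rewrite eqz_mod_dvd E7.
  have -> : l%:Z ^+ 6 - 1 = (l ^ 6).-1%:Z; last exact: h7.
  by rewrite predn_int ?expn_gt0 ?prime_gt0 // -[(l ^ 6)%N%:Z]natz natrX natz.
apply: ltn_pdiv2_prime; first exact: ltnW.
(* The least prime factor has square at least 49^r, which exceeds 14^r + 1. *)
rewrite -/l (@leq_trans (7 ^ r * 7 ^ r)) //; last by rewrite expnS expn1 leq_mul.
rewrite ME -expnMn -[(7 * 7)%N]/49%N -[r](prednK (ltnW r_gt1)) !expnS.
have : (14 ^ r.-1 <= 49 ^ r.-1)%N by rewrite leq_exp2r // -ltnS (prednK (ltnW r_gt1)).
by have : (0 < 14 ^ r.-1)%N; rewrite ?expn_gt0 //; lia.
Qed.

End Criterion.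

Theorem proposition4p3
  (R : realType)
  (* L is the field Q(zeta_14), embedded by iota in the complex numbers *)
  (L : splittingFieldType rat) (iota : {rmorphism L -> R[i]})
  (z14 z7 : L)
  (hz14 : iota z14 = zeta R 14) (hz7 : iota z7 = zeta R 7)
  (hL : <<1%VS; z14>>%VS = fullv)
  (bar : L -> L) (hbar : forall x : L, iota (bar x) = (iota x)^*)
  (sigma : nat -> gal_of {:L})
  (hsigma : forall c : nat, coprime c 14 ->
     sigma c \in 'Gal({:L} / 1)%g /\ sigma c z14 = z14 ^+ c)
  (n : nat) (hn : (1 < n)%N) :
  let r := (2 ^ n)%N in
  let M := (14 ^ (2 ^ n) + 1)%N in
  let p : L := 1 - z7 + z7 ^+ 4 in
  let alpha : L :=
    galZ_pow (p / bar p)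
      (galZ_elt (sigma 1%N) + galZ_elt (sigma 5%N) *+ 3
                            + galZ_elt (sigma 3%N) *+ 5) in
  let alpha1 (k : nat) : L := alpha ^+ (14 ^ k) + bar alpha ^+ (14 ^ k) in
  let alpha2 (k : nat) : L := sigma 3%N (alpha1 k) in
  let alpha3 (k : nat) : L := sigma 5%N (alpha1 k) in
  let S1 (k : nat) : L := alpha1 k + alpha2 k + alpha3 k in
  let S2 (k : nat) : L :=
    alpha1 k * alpha2 k + alpha1 k * alpha3 k + alpha2 k * alpha3 k in
  let S3 (k : nat) : L := alpha1 k * alpha2 k * alpha3 k in
  (forall x : int, 1 < x -> x < 7 ^+ r ->
     (x ^+ 6 = 1 %[mod 7 ^+ r])%Z -> ~~ (x %| M%:Z)%Z) ->
  prime M <->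
    ((M%:Z = 8 %[mod 29])%Z \/ (M%:Z = - 8 %[mod 29])%Z) /\
      [/\ congr_modQ M (S1 (r - 1)%N) 1,
          congr_modQ M (S2 (r - 1)%N) (- 2) &
          congr_modQ M (S3 (r - 1)%N) (- 1)]
    \/
    (M%:Z = - 5 %[mod 29])%Z /\
      [/\ congr_modQ M (S1 (r - 1)%N) (- 1),
          congr_modQ M (S2 (r - 1)%N) (- 2) &
          congr_modQ M (S3 (r - 1)%N) 1].
Proof.
move=> r M p alpha alpha1 alpha2 alpha3 S1 S2 S3 hx.
have r_gt1 : (1 < r)%N by rewrite (@leq_trans (2 ^ 1)) // leq_exp2l // ltnW.
pose N := (14 ^ r.-1)%N.
have iota_inj : injective iota := fmorph_inj iota.
have z7E : z7 = z14 ^+ 2 by apply: iota_inj; rewrite rmorphXn /= hz14 hz7 zeta14_sq.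
have hw : phi7 z7 = 0.
  by apply: iota_inj; rewrite rmorph_phi7 /= hz7 zeta7_phi7 rmorph0.
have nzL : 29%:R != 0 :> L by rewrite -(fmorph_eq0 iota) rmorph_nat pnatr_eq0.
have conj7 : (iota z7)^* = iota (z7 ^+ 6).
  rewrite rmorphXn /= hz7; have z0 := phi7_neq0 (zeta7_phi7 R).
  by apply: (mulIf z0); rewrite zeta_norm -exprSr zeta7_expr7.
have bar_pi : bar p = pi29 (z7 ^+ 6).
  by apply: iota_inj; rewrite hbar -[p]/(pi29 z7) rmorph_pi29 (rmorph_pi29 Num.conj) /= conj7 -rmorph_pi29.
have sig_z7 c : coprime c 14 -> sigma c z7 = z7 ^+ c.
  by move=> /hsigma[_ e]; rewrite z7E rmorphXn /= e -!exprM mulnC.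
have alphaE : alpha = alpha29 z7.
  have /and5P[p1 p2 _ p4 /andP[_ p6]] := pi29_neq0 hw nzL.
  have x0 : p / bar p != 0 by rewrite bar_pi mulf_neq0 ?invr_neq0.
  rewrite /alpha (galZ_powD x0 (_ + _)) (galZ_powD x0 _ (_ *+ 3)) !galZ_powMn // !galZ_pow_elt ?(hsigma _ _).1 //.
  rewrite bar_pi -[p]/(pi29 z7) !fmorph_div !rmorph_pi29 !rmorphXn /= !sig_z7 //.
  rewrite -!exprM !(phi7_expr_mod hw (_ * 6)) /= expr1.
  rewrite -[(1 * 6 %% 7)%N]/6%N -[(5 * 6 %% 7)%N]/2%N -[(3 * 6 %% 7)%N]/4%N.
  by rewrite /alpha29; field; do ?[apply/andP; split].
have bar_alpha : bar alpha = alpha29 (z7 ^+ 6).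
  by apply: iota_inj; rewrite hbar alphaE rmorph_alpha29 (rmorph_alpha29 Num.conj) /= conj7 -rmorph_alpha29.
have a1E : alpha1 (r - 1)%N = half_trace N z7.
  by rewrite /alpha1 bar_alpha alphaE subn1.
have a2E : alpha2 (r - 1)%N = half_trace N (z7 ^+ 3).
  by rewrite /alpha2 a1E rmorph_half_trace /= sig_z7.
have a3E : alpha3 (r - 1)%N = half_trace N (z7 ^+ 5).
  by rewrite /alpha3 a1E rmorph_half_trace /= sig_z7.
have S1E : S1 (r - 1)%N = sym1 N z7 by rewrite /S1 a1E a2E a3E.
have S2E : S2 (r - 1)%N = sym2 N z7 by rewrite /S2 a1E a2E a3E.
have S3E : S3 (r - 1)%N = sym3 N z7 by rewrite /S3 a1E a2E a3E.
have [m mP] := sym_integral N.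
have M29c := fermat29_residue n hn; rewrite -/M in M29c.
have M29 : ~~ (29 %| M)%N.
  by move: M29c; rewrite !inE /dvdn => /or3P[] /eqP ->.
have cM k : coprime (29 ^ k) M by rewrite coprimeXl // prime_coprime.
have p29 k : (0 < 29 ^ k)%N by rewrite expn_gt0.
have [m1 m2 m3] := mP _ _ hw nzL; rewrite -!natrX in m1 m2 m3.
(* Case (i) is [e = -1] and case (ii) is [e = 1]. *)
have congrE e : sym_congr M N m e <->
    [/\ congr_modQ M (S1 (r - 1)%N) (- e), congr_modQ M (S2 (r - 1)%N) (- 2)
      & congr_modQ M (S3 (r - 1)%N) e].
  have q1 := congr_modQ_frac L M _ _ (- e) _ (cM _) (p29 _) m1.
  have q2 := congr_modQ_frac L M _ _ (- 2) _ (cM _) (p29 _) m2.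
  have q3 := congr_modQ_frac L M _ _ e _ (cM _) (p29 _) m3.
  by rewrite S1E S2E S3E; split=> -[c1 c2 c3]; split; by [apply/q1|apply/q2|apply/q3].
have crit k := prime_sym_congr r M N m r_gt1 erefl erefl mP M29 k.
have conv s := sym_congr_prime r M N m r_gt1 erefl erefl mP M29 s hx.
rewrite !modz_nat; split=> [pM|[[_ h]|[_ h]]]; last first.
- by apply: (conv false); apply: (congrE 1).2.
- by apply: (conv true); apply: (congrE (-1)).2.
(* Modulo 29 the residues 8, 21, 24 are 2^3, 2^17, 2^8; the parity of the exponent gives the sign
   [e], and none is a multiple of 7. *)
move: M29c; rewrite !inE => /or3P[]/eqP M29E; rewrite M29E.
- left; split; first by left.
  by apply: (congrE (-1)).1; apply: (crit 3%N) => //; rewrite M29E.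
- left; split; first by right.
  by apply: (congrE (-1)).1; apply: (crit 17%N) => //; rewrite M29E.
right; split=> //; apply: (congrE 1).1.
by apply: (crit 8%N) => //; rewrite M29E.
Qed.
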